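(* Let $R=\mathbb{C}[x_1,\dots,x_N]$ be graded by a finitely generated abelian group $M$ via $\deg(x_i)=d_i\in M$, with $\dim_{\mathbb{C}}(R_0)=1$, and let $I\subseteq R$ be an $M$-graded ideal. Then the Macaulay dual space $D_0(I)$ is also $M$-graded, that is, $$D_0(I)=\bigoplus_{m\in M} D_0^m(I),\qquad\text{where } D_0^m(I)=D_0^m\cap D_0(I).$$
   Context: Grading: given $d_1,\dots,d_N\in M$, set $\deg(x^\alpha)=\sum_{i=1}^N\alpha_i d_i\in M$ for $\alpha\in(\mathbb{Z}_{\ge 0})^N$, and for $m\in M$ let $R_m=\mathrm{span}_{\mathbb{C}}\{x^\alpha : \deg(x^\alpha)=m\}$, so $R=\bigoplus_{m\in M}R_m$. A polynomial in $R_m$ is called $M$-homogeneous of degree $m$. An ideal is $M$-graded if it is generated by $M$-homogeneous polynomials. Standing assumption: $\dim_{\mathbb{C}}(R_0)=1$, i.e. $R_0=\mathbb{C}$ (equivalently $\dim_{\mathbb{C}} R_m<\infty$ for all $m\in M$). Dual spaces: for $\alpha\in(\mathbb{Z}_{\ge 0})^N$ let $\partial_\alpha:R\to\mathbb{C}$ be the linear functional $\partial_\alpha(g)=\frac{1}{\alpha!}\frac{\partial^{|\alpha|}g}{\partial x_1^{\alpha_1}\cdots\partial x_N^{\alpha_N}}\Big|_{x=0}$, where $\alpha!=\prod_i\alpha_i!$ and $|\alpha|=\sum_i\alpha_i$ (i.e. $\partial_\alpha(g)$ is the coefficient of $x^\alpha$ in $g$). Let $D_0=\mathrm{span}_{\mathbb{C}}\{\partial_\alpha:\alpha\in(\mathbb{Z}_{\ge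 0})^N\}$ (finite linear combinations), and for $m\in M$ let $D_0^m=\mathrm{span}_{\mathbb{C}}\{\partial_\alpha:\deg(x^\alpha)=m\}$, so $D_0=\bigoplus_{m\in M}D_0^m$. The Macaulay dual space of an ideal $I$ at $0$ is $D_0(I)=\{\partial\in D_0:\partial(g)=0\text{ for all }g\in I\}$. *)

(* Defs.v *)
From HB Require Import structures.
From mathcomp Require Import all_boot all_order all_algebra.
From mathcomp Require Import boolp classical_sets functions reals.
From mathcomp Require Import complex mpoly.
Set Implicit Arguments.
Unset Strict Implicit.
Unset Printing Implicit Defensive.
Import GRing.Theory.
Local Open Scope classical_set_scope.
Local Open Scope ring_scope.

Definition finitely_generated (M : zmodType) : Prop :=
  exists s : seq M, forall m : M,
    exists c : 'I_(size s) -> int, m = \sum_(i < size s) s`_i *~ c i.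

Section LinearAlgebra.
Variables (K : fieldType) (V : lmodType K).
Implicit Types S W : set V.

Definition subspace S : Prop :=
  S 0 /\ forall (a : K) (u v : V), S u -> S v -> S (a *: u + v).

Definition lspan S : set V :=
  [set v | exists (n : nat) (c : 'I_n -> K) (u : 'I_n -> V),
     (forall i, S (u i)) /\ v = \sum_i c i *: u i].

Definition lin_indep (n : nat) (b : 'I_n -> V) : Prop :=
  forall c : 'I_n -> K, \sum_i c i *: b i = 0 -> forall i, c i = 0.

Definition has_dim W (n : nat) : Prop :=
  exists b : 'I_n -> V, lin_indep b /\ W = lspan (range b).

(* Internal direct sum over a possibly infinite index set: W is the set of
   finite sums of elements of the W_m, and such decompositions are unique. *)
Definition is_direct_sum (M : eqType) W (Wm : M -> set V) : Prop :=
  [/\ forall m, subspace (Wm m),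
      forall v, W v <-> exists (s : seq M) (f : M -> V),
        [/\ uniq s, forall m, m \in s -> Wm m (f m) & v = \sum_(m <- s) f m]
    & forall (s : seq M) (f : M -> V), uniq s ->
        (forall m, m \in s -> Wm m (f m)) ->
        \sum_(m <- s) f m = 0 -> forall m, m \in s -> f m = 0].

End LinearAlgebra.

Definition is_ideal (A : comNzRingType) (I : set A) : Prop :=
  [/\ I 0, forall f g, I f -> I g -> I (f + g) & forall a f, I f -> I (a * f)].

Section Grading.
Variables (K : fieldType) (M : zmodType) (N : nat) (d : 'I_N -> M).

Definition gdeg (a : 'X_{1..N}) : M := \sum_(i < N) d i *+ a i.

Definition homog_part (m : M) : set {mpoly K[N]} :=
  lspan [set g | exists a : 'X_{1..N}, gdeg a = m /\ g = 'X_[a]].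

Definition graded_ideal (I : set {mpoly K[N]}) : Prop :=
  is_ideal I /\
  exists G : set {mpoly K[N]},
    (forall g, G g -> exists m, homog_part m g) /\
    I = smallest (@is_ideal {mpoly K[N]}) G.

(* K^o is K as a module over itself, so that functionals form the K-module
   {mpoly K[N]} -> K^o with pointwise operations. *)
Definition dpartial (a : 'X_{1..N}) : {mpoly K[N]} -> K^o :=
  fun g => ((\prod_(i < N) (a i)`!)%:R)^-1 * (g^`M[a]).@[fun=> 0].

Definition dual0 : set ({mpoly K[N]} -> K^o) := lspan (range dpartial).

Definition dual0_part (m : M) : set ({mpoly K[N]} -> K^o) :=
  lspan [set phi | exists a : 'X_{1..N}, gdeg a = m /\ phi = dpartial a].

Definition macaulay_dual (I : set {mpoly K[N]}) : set ({mpoly K[N]} -> K^o) :=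
  [set phi | dual0 phi /\ forall g, I g -> phi g = 0].

Definition macaulay_dual_part (I : set {mpoly K[N]}) (m : M) :
    set ({mpoly K[N]} -> K^o) :=
  dual0_part m `&` macaulay_dual I.

End Grading.
Arguments homog_part K {M N} d m _.

(* Main.v *)
(** A functional in the span of the [dpartial a] with [gdeg a = m] is unchanged
    by precomposition with the projection onto the degree-[m] part and is
    killed by the projections onto the other degrees.  Hence the degree-[m]
    component of [phi] is [phi] composed with that projection, which makes the
    decomposition unique; and since a graded ideal is stable under these
    projections, the components of a functional vanishing on [I] vanish on
    [I]. *)
Require Import Defs.
From HB Require Import structures.
From mathcomp Require Import all_boot all_order all_algebra.
From mathcomp Require Import boolp classical_sets functions reals.
From mathcomp Require Import complex mpoly.
Import GRing.Theory Num.Theory.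
Local Open Scope classical_set_scope.
Local Open Scope ring_scope.

Section Spans.
Context {K : fieldType} {V : lmodType K}.
Implicit Types S W : set V.

Lemma sub_lspan S : S `<=` lspan S.
Proof.
move=> v Sv; exists 1, (fun=> 1), (fun=> v); split=> //.
by rewrite big_ord1 scale1r.
Qed.

Lemma subspaceD W u v : subspace W -> W u -> W v -> W (u + v).
Proof. by move=> [_ WD] Wu Wv; rewrite -[u]scale1r; apply: WD. Qed.

Lemma subspaceZ W a u : subspace W -> W u -> W (a *: u).
Proof. by move=> [W0 WD] Wu; rewrite -[a *: u]addr0; apply: WD. Qed.

Lemma subspace_sum W (I : eqType) (s : seq I) (F : I -> V) :
  subspace W -> (forall i, i \in s -> W (F i)) -> W (\sum_(i <- s) F i).
Proof.
move=> Wsub WF; rewrite big_seq; apply: big_ind => //; first by case: Wsub.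
by move=> u v Wu Wv; apply: subspaceD.
Qed.

Lemma subspaceI S W : subspace S -> subspace W -> subspace (S `&` W).
Proof.
move=> [S0 SD] [W0 WD]; split=> // a u v [Su Wu] [Sv Wv].
by split; [apply: SD | apply: WD].
Qed.

(** Serves as an induction principle for spans: with [W] the set of vectors having some linear
    property, the property only has to be checked on generators. *)
Lemma lspan_sub S W : subspace W -> S `<=` W -> lspan S `<=` W.
Proof.
move=> Wsub SW v [n [c [u [Su ->]]]].
by apply: subspace_sum => // i _; apply: subspaceZ => //; apply: SW.
Qed.

Lemma lspanS S W : S `<=` W -> lspan S `<=` lspan W.
Proof.
by move=> SW v [n [c [u [Su ->]]]]; exists n, c, u; split=> // i; apply: SW.
Qed.

Lemma lspan_subspace S : subspace (lspan S).
Proof.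
split.
  exists 0, (fun=> 0), (fun=> 0); split; first by case.
  by rewrite big_ord0.
move=> a _ _ [n1 [c1 [u1 [Su1 ->]]]] [n2 [c2 [u2 [Su2 ->]]]].
(* Polymorphic in [T], since both the coefficients and the vectors get concatenated. *)
pose glue T (f1 : 'I_n1 -> T) (f2 : 'I_n2 -> T) (i : 'I_(n1 + n2)) :=
  match fintype.split i with inl j => f1 j | inr j => f2 j end.
exists (n1 + n2)%N, (glue _ (fun i => a * c1 i) c2), (glue _ u1 u2); split.
  by move=> i; rewrite /glue; case: fintype.split.
rewrite big_split_ord scaler_sumr; congr (_ + _); apply: eq_bigr => i _.
  by rewrite /glue (unsplitK (inl i)) scalerA.
by rewrite /glue (unsplitK (inr i)).
Qed.

End Spans.

Section Projections.
Context {K : fieldType} {M : zmodType} {N : nat} (d : 'I_N -> M).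
Implicit Types (f g : {mpoly K[N]}) (a b : 'X_{1..N}) (m : M).

(** The index set depends on [g], so linearity is not visible here; it is read off from the
    coefficients given by [mcoeff_hproj]. *)
Definition hproj m g : {mpoly K[N]} :=
  \sum_(a <- msupp g | gdeg d a == m) g@_a *: 'X_[a].

Lemma mcoeff_hproj m g b :
  (hproj m g)@_b = if gdeg d b == m then g@_b else 0.
Proof.
rewrite /hproj raddf_sum /=.
under eq_bigr do rewrite mcoeffZ mcoeffX.
case: ifP => [db|/negP db]; last first.
  rewrite big1 // => a /eqP da; have [eq_ab|] := eqVneq a b; last by rewrite mulr0.
  by case: db; rewrite -eq_ab da.
have [bg|bg] := boolP (b \in msupp g); last first.
  rewrite memN_msupp_eq0 // big1_seq // => a /andP[_ ag].
  have [eq_ab|] := eqVneq a b; last by rewrite mulr0.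
  by rewrite -eq_ab ag in bg.
rewrite big_mkcond (bigD1_seq b) ?msupp_uniq //= db eqxx mulr1 big1 ?addr0 //.
by move=> a /negPf ->; rewrite mulr0 if_same.
Qed.

Lemma hproj_linear m : linear (hproj m).
Proof.
move=> c f g; apply/mpolyP => b.
rewrite mcoeffD mcoeffZ !mcoeff_hproj mcoeffD mcoeffZ.
by case: ifP; rewrite ?mulr0 ?addr0.
Qed.

HB.instance Definition _ m :=
  GRing.isLinear.Build K {mpoly K[N]} {mpoly K[N]} _ (hproj m) (hproj_linear m).

Lemma gdegD a b : gdeg d (a + b)%MM = gdeg d a + gdeg d b.
Proof.
rewrite /gdeg -big_split; apply: eq_bigr => i _ /=.
by rewrite mnmDE mulrnDr.
Qed.

Lemma hprojX m a : hproj m 'X_[a] = if gdeg d a == m then 'X_[a] else 0.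
Proof.
apply/mpolyP => b; rewrite mcoeff_hproj mcoeffX.
have [<-|/negPf ne_ab] := eqVneq a b; first by case: ifP; rewrite ?mcoeff0 ?mcoeffX ?eqxx.
by rewrite if_same; case: ifP; rewrite ?mcoeff0 ?mcoeffX ?ne_ab.
Qed.

(** Degrees of monomials add, so multiplying by ['X_[a]] only shifts the grading; by linearity in
    [g] it suffices to compare monomials. *)
Lemma hprojXM m a g :
  hproj m ('X_[a] * g) = 'X_[a] * hproj (m - gdeg d a) g.
Proof.
elim/mpolyind: g => [|c b g _ _ IH]; first by rewrite !(mulr0, linear0).
rewrite mulrDr !linearD /= mulrDr IH -scalerAr !linearZ /= -scalerAr.
congr (_ *: _ + _); rewrite -mpolyXD !hprojX gdegD.
rewrite [in RHS]eq_sym subr_eq [_ + gdeg d a]addrC eq_sym.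
by case: ifP; rewrite ?mulr0 // mpolyXD.
Qed.

Lemma hproj_homog m n g :
  homog_part K d n g -> hproj m g = if n == m then g else 0.
Proof.
pose W := [set g | hproj m g = if n == m then g else 0].
suff: homog_part K d n `<=` W by apply.
apply: lspan_sub => [|_ [a [da ->]]]; last by rewrite /W /= hprojX da.
split=> [|c u v]; rewrite /W /=; first by rewrite linear0 if_same.
move=> Wu Wv; rewrite linearP /= Wu Wv; case: ifP => // _.
by rewrite scaler0 addr0.
Qed.

Lemma hproj_graded_ideal {I : set {mpoly K[N]}} m g :
  graded_ideal d I -> I g -> I (hproj m g).
Proof.
move=> [[I0 ID IM] [G [Ghom IE]]] Ig.
(* The set on the right is an ideal containing the homogeneous generators. All degrees are
   quantified at once because multiplication by a monomial moves one projection to another. *)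
suff IJ : I `<=` [set g | forall m, I (hproj m g)] by apply: IJ.
rewrite {1}IE; apply: smallest_sub; last first.
  move=> f Gf n; have [k fk] := Ghom f Gf; rewrite (hproj_homog _ _ _ fk).
  by case: ifP => _ //; rewrite IE; apply: sub_gen_smallest.
split=> [n|f h If Ih n|f h Ih n] /=; first by rewrite linear0.
  by rewrite linearD; apply: ID; [apply: If | apply: Ih].
(* Splitting the multiplier [f] into monomials makes [hprojXM] applicable to each term. *)
rewrite [f]mpolyE mulr_suml linear_sum /=; apply: big_ind => // a _.
by rewrite -scalerAl linearZ /= -mul_mpolyC hprojXM; exact: IM _ _ (IM _ _ (Ih _)).
Qed.

End Projections.

Section DualSpace.
Context {K : fieldType} {M : zmodType} {N : nat} (d : 'I_N -> M).
Hypothesis charK : [pchar K] =i pred0.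
Implicit Types (g : {mpoly K[N]}) (a : 'X_{1..N}) (m : M).
Implicit Types (phi : {mpoly K[N]} -> K^o) (I : set {mpoly K[N]}).

Lemma meval0_mcoeff g : g.@[fun=> 0] = g@_0.
Proof.
elim/mpolyind: g => [|c a g _ _ IH]; first by rewrite meval0 mcoeff0.
rewrite mevalD mcoeffD IH mevalZ mcoeffZ mevalX mcoeffX; congr (_ * _ + _).
have [->|/eqP ne_a0] := eqVneq a 0%MM.
  by rewrite big1 // => i _; rewrite mnm0E.
have [i ai] : exists i, a i != 0%N.
  apply/existsP; apply: contra_notT ne_a0 => /existsPn a0.
  by apply/mnmP => i; rewrite mnm0E; apply/eqP; rewrite -[_ == _]negbK.
by rewrite (bigD1 i) //= expr0n (negPf ai) mul0r.
Qed.

Lemma dpartialE a g : dpartial a g = g@_a.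
Proof.
rewrite /dpartial meval0_mcoeff mcoeff_mderivm addm0.
under [X in _ * (_ *+ X)]eq_bigr do rewrite ffactnn.
rewrite -[X in _ * X]mulr_natl mulKf // (pcharf0P _).1 // -lt0n.
by rewrite prodn_gt0 // => i; apply: fact_gt0.
Qed.

Lemma dpartial_hproj m a :
  @dpartial K N a \o hproj d m = if gdeg d a == m then @dpartial K N a else 0.
Proof.
apply/funext => g /=; rewrite dpartialE mcoeff_hproj.
by case: ifP => _; rewrite ?dpartialE.
Qed.

Lemma dual0_part_hproj m n phi :
  dual0_part d n phi -> phi \o hproj d m = if n == m then phi else 0.
Proof.
pose W := [set phi : {mpoly K[N]} -> K^o |
  phi \o hproj d m = if n == m then phi else 0].
suff: dual0_part d n `<=` W by apply.
apply: lspan_sub => [|_ [a [da ->]]]; last by rewrite /W /= dpartial_hproj da.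
split=> [|c u v]; rewrite /W /=; first by rewrite if_same.
(* Operations on functionals are pointwise, so precomposition distributes over them by
   conversion. *)
move=> Wu Wv; rewrite [LHS](_ : _ = c *: (u \o hproj d m) + (v \o hproj d m)) //.
by rewrite Wu Wv; case: ifP => // _; rewrite scaler0 addr0.
Qed.

Lemma dual0_part_sub m : @dual0_part K M N d m `<=` @dual0 K N.
Proof. by apply: lspanS => _ [a [_ ->]]; exists a. Qed.

Lemma dual0_comp_hproj m phi : dual0 phi -> dual0_part d m (phi \o hproj d m).
Proof.
pose W := [set phi : {mpoly K[N]} -> K^o | dual0_part d m (phi \o hproj d m)].
suff: @dual0 K N `<=` W by apply.
have [P0 PD] : subspace (@dual0_part K M N d m) := lspan_subspace _.
apply: lspan_sub => [|_ [a _ <-]]; last first.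
  rewrite /W /= dpartial_hproj; case: ifP => [/eqP da|_] //.
  by apply: sub_lspan; exists a.
by split=> // c u v Wu Wv; apply: PD.
Qed.

Lemma dual0_sum_hproj phi : dual0 phi ->
  exists2 s : seq M, uniq s & phi = \sum_(m <- s) (phi \o hproj d m).
Proof.
move=> [n [c [u [Su ->]]]].
have /choice[a ua] : forall i, exists a, @dpartial K N a = u i.
  by move=> i; have [a _ <-] := Su i; exists a.
(* Only the degrees of the finitely many [dpartial (a i)] occurring in [phi] can contribute; [undup]
   keeps a shared degree from being counted twice. *)
exists (undup [seq gdeg d (a i) | i <- enum 'I_n]); first exact: undup_uniq.
set s := undup _.
transitivity (\sum_(m <- s) \sum_i c i *: (u i \o hproj d m)); last first.
  apply: eq_bigr => m _; apply/funext => g /=.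
  by rewrite !fct_sumE.
(* For fixed [i], the only surviving degree is [gdeg d (a i)], where the projection leaves [u i]
   unchanged. *)
rewrite exchange_big; apply: eq_bigr => i _ /=.
rewrite -scaler_sumr; congr (_ *: _).
have ai_s : gdeg d (a i) \in s
  by rewrite mem_undup; apply/mapP; exists i; rewrite ?mem_enum.
rewrite (bigD1_seq _ ai_s (undup_uniq _)) /= big1 => [|m ne_m];
  rewrite -ua dpartial_hproj ?eqxx ?addr0 //.
by rewrite eq_sym (negPf ne_m).
Qed.

Lemma macaulay_dual_subspace I : subspace (macaulay_dual I).
Proof.
apply: subspaceI; first exact: lspan_subspace.
split=> // c u v Iu Iv g Ig.
by rewrite [LHS](_ : _ = c *: u g + v g) // Iu ?Iv // scaler0 addr0.
Qed.

Lemma macaulay_dual_direct_sum I :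
  graded_ideal d I -> is_direct_sum (macaulay_dual I) (macaulay_dual_part d I).
Proof.
move=> gI; split.
- move=> m; apply: subspaceI; first exact: lspan_subspace.
  exact: macaulay_dual_subspace.
- move=> phi; split=> [[phiD phiI]|[s [f [_ sf ->]]]].
    have [s s_uniq phiE] := dual0_sum_hproj _ phiD.
    exists s, (fun m => phi \o hproj d m); split=> // m _.
    have phim := dual0_comp_hproj m _ phiD.
    split=> //; split=> [|g Ig]; first exact: dual0_part_sub phim.
    by apply: phiI; apply: hproj_graded_ideal.
  apply: subspace_sum => [|m /sf[]//]; exact: macaulay_dual_subspace.
- move=> s f s_uniq sf sum0 m ms.
  (* Precomposing with the projection extracts the summand [f m], so a vanishing sum forces it to
     vanish; [s_uniq] ensures that [m] occurs only once. *)
  have <- : (\sum_(n <- s) f n) \o hproj d m = f m; last by rewrite sum0.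
  transitivity (\sum_(n <- s) (f n \o hproj d m)).
    by apply/funext => g; rewrite /= !fct_sumE.
  have fh n : n \in s -> f n \o hproj d m = if n == m then f n else 0.
    by move=> /sf[/dual0_part_hproj].
  rewrite (bigD1_seq _ ms) //= fh // eqxx big_seq_cond big1 ?addr0 //.
  by move=> n /andP[ns /negPf ne_nm]; rewrite fh // ne_nm.
Qed.

End DualSpace.

Theorem theorem3p2 (R : realType) (M : zmodType) (N : nat) (d : 'I_N -> M)
    (hM : finitely_generated M)
    (hR0 : has_dim (homog_part R[i] d 0) 1)
    (I : set {mpoly R[i][N]}) (hI : graded_ideal d I) :
  is_direct_sum (macaulay_dual I) (macaulay_dual_part d I).
Proof. by apply: macaulay_dual_direct_sum => //; apply: pchar_num. Qed.
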